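(* There exist universal constants $0<c\le C$ such that for every sequence $p=(p(j))_{j\ge1}$ with $p(j)\in[0,\frac12]$ and $p(j)\ge p(j+1)$ for all $j\ge1$, there exists a probability distribution $\mu$ on $\{0,1\}^{\mathbb N}$ with $\mathbb E_{X\sim\mu}[X]=p$ such that for all $n\ge1$, $$c\,\min\left(p(1),\sqrt{\frac{p(1)}{n}}\right)\le\Delta_n(\mu)\le C\,\min\left(p(1),\sqrt{\frac{p(1)}{n}}\right).$$
   Context: For i.i.d. samples $X_1,\dots,X_n\sim\mu$ and $\hat p_n=\frac1n\sum_{i=1}^nX_i$, $\Delta_n(\mu)=\mathbb E\|\hat p_n-p\|_\infty=\mathbb E\sup_{j\ge1}|\hat p_n(j)-p(j)|$. The distribution $\mu$ need not be a product distribution. *)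

(* Defs.v *)
From HB Require Import structures.
From mathcomp Require Import all_boot all_order all_algebra.
From mathcomp Require Import all_classical all_reals all_analysis.

Set Implicit Arguments.
Unset Strict Implicit.
Unset Printing Implicit Defensive.
Import Order.TTheory GRing.Theory Num.Theory.

Local Open Scope classical_set_scope.
Local Open Scope ring_scope.

Section iid.
Context d (T : measurableType d) (R : realType).

Definition cons_pair n (z : T * n.-tuple T) : n.+1.-tuple T :=
  [the n.+1.-tuple T of z.1 :: z.2].

Lemma measurable_cons_pair n : measurable_fun setT (@cons_pair n).
Proof. exact: measurable_cons. Qed.

HB.instance Definition _ n :=
  isMeasurableFun.Build _ _ _ _ (@cons_pair n) (@measurable_cons_pair n).

(* The joint law of n i.i.d. samples from mu, i.e., the n-fold product of mu,
   as characterised by iid_powerE. *)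
Fixpoint iid_power (mu : probability T R) (n : nat) :
    probability (n.-tuple T) R :=
  match n with
  | 0 => dirac [tuple]
  | m.+1 => distribution (mu \x iid_power mu m)%E (@cons_pair m)
  end.

Lemma measurable_box n (A : 'I_n -> set T) : (forall i, measurable (A i)) ->
  measurable [set s : n.-tuple T | forall i, A i (tnth s i)].
Proof.
move=> mA; rewrite (_ : [set _ | _] =
  \bigcap_(i in [set: 'I_n]) ((@tnth n T ^~ i) @^-1` A i)); last first.
  by apply/seteqP; split => s /= h; [move=> i _; exact: h|move=> i; exact: h].
apply: fin_bigcap_measurable => [|i _]; first exact: finite_finset.
by rewrite -[X in measurable X]setTI; exact: measurable_tnth.
Qed.

Lemma iid_powerE (mu : probability T R) n (A : 'I_n -> set T) :
  (forall i, measurable (A i)) ->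
  iid_power mu n [set s | forall i, A i (tnth s i)] = (\prod_(i < n) mu (A i))%E.
Proof.
elim: n A => [|n IHn] A mA.
  by rewrite big_ord0 /= diracE mem_set // => -[].
have mS i : measurable (A (lift ord0 i)) by exact: mA.
rewrite big_ord_recl -IHn //.
rewrite -(product_measure1E _ _ (mA ord0) (measurable_box mS)).
rewrite /= /distribution /pushforward; congr ((_ \x _)%E _).
apply/seteqP; split => -[x s] /=.
  move=> h; split => [|i]; first by have := h ord0; rewrite tnth0.
  by have := h (lift ord0 i); rewrite tnthS.
by move=> [h0 hS] i; case: (unliftP ord0 i) => [j|] ->; rewrite ?tnthS ?tnth0.
Qed.

End iid.

(* {0,1}^N with its product sigma-algebra, i.e., the one generated by the
   coordinate maps. Coordinates are indexed from 0. *)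
Definition binseq := g_sigma_algebraType
  (\bigcup_j preimage_set_system setT (fun x : nat -> bool => x j) measurable).

Section empirical_mean.
Context (R : realType).

Definition coordinate (j : nat) (x : binseq) : R := (x j)%:R.

Lemma measurable_coordinate j : measurable_fun setT (coordinate j).
Proof.
apply: (@measurableT_comp _ _ _ _ _ _ (fun b : bool => b%:R : R)) => //.
move=> _ B mB; apply: sub_sigma_algebra; exists j => //; exists B => //.
Qed.

Definition mean (mu : probability binseq R) (j : nat) : R :=
  fine ('E_mu[coordinate j])%E.

Definition empirical_mean n (s : n.-tuple binseq) (j : nat) : R :=
  n%:R^-1 * \sum_(i < n) coordinate j (tnth s i).

(* Only used on bounded families, for which the real-valued [sup] is genuine:
   empirical means and means all lie in [0, 1]. *)
Definition linf_dist (u v : nat -> R) : R :=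
  sup [set `|u j - v j| | j in [set: nat]].

Definition Delta n (mu : probability binseq R) : \bar R :=
  ('E_(iid_power mu n) [fun s => linf_dist (empirical_mean s) (mean mu)])%E.

End empirical_mean.

(* Main.v *)
(* Take X(j) = 1{U <= p(j)} with U uniform on [0, 1], so that the empirical
   means are the values at p(1) >= p(2) >= ... of the empirical distribution
   function F_n.
   Upper bound: t |-> (F_n(t) - t) / (1 - t) is a martingale, so Doob's L2
   inequality on [0, p(1)] controls the supremum by its terminal variance, at
   most 2 p(1) / n. For small n, the crude bound F_n(p(1)) + p(1) has mean
   2 p(1).
   Lower bound: keep only j = 1. The binomial sum S = n (F_n(p(1)) - p(1)) has
   E S^2 of order m = n p(1) and E S^4 of order m max(1, m), and
   |S| >= S^2 / l - S^4 / l^3 with l of order sqrt (max(1, m)). *)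
Require Import Defs.
From HB Require Import structures.
From mathcomp Require Import all_boot all_order all_algebra.
From mathcomp Require Import all_classical all_reals all_analysis.
From mathcomp Require Import measurable_realfun ring lra.
Import Order.TTheory GRing.Theory Num.Theory.
Import numFieldNormedType.Exports.
Local Open Scope classical_set_scope.
Local Open Scope ring_scope.

Set Implicit Arguments.
Unset Strict Implicit.
Unset Printing Implicit Defensive.

(** * Means of bounded measurable functions *)

Section bounded_measurable.
Context d (T : measurableType d) (R : realType).
Implicit Types f g : T -> R.

(** All random variables below are built from 0/1 coordinates, so this one class, stable under the
    operations used, discharges every integrability condition. *)
Definition bounded_measurable f :=
  measurable_fun setT f /\ exists M, forall x, `|f x| <= M.

Lemma bounded_measurable_cst (c : R) : bounded_measurable (fun=> c).
Proof. by split => //; exists `|c|. Qed.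

Lemma bounded_measurableD f g : bounded_measurable f -> bounded_measurable g ->
  bounded_measurable (fun x => f x + g x).
Proof.
move=> [mf [M fM]] [mg [N gN]]; split; first exact: measurable_funD.
by exists (M + N) => x; rewrite (le_trans (ler_normD _ _))// lerD.
Qed.

Lemma bounded_measurableM f g : bounded_measurable f -> bounded_measurable g ->
  bounded_measurable (fun x => f x * g x).
Proof.
move=> [mf [M fM]] [mg [N gN]]; split; first exact: measurable_funM.
by exists (M * N) => x; rewrite normrM ler_pM.
Qed.

Lemma bounded_measurableZ (c : R) f :
  bounded_measurable f -> bounded_measurable (fun x => c * f x).
Proof. exact/bounded_measurableM/bounded_measurable_cst. Qed.

Lemma bounded_measurableB f g : bounded_measurable f -> bounded_measurable g ->
  bounded_measurable (fun x => f x - g x).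
Proof.
move=> bf /(bounded_measurableZ (-1)) bg.
by under eq_fun do rewrite -mulN1r; exact: bounded_measurableD.
Qed.

Lemma bounded_measurableX f n :
  bounded_measurable f -> bounded_measurable (fun x => f x ^+ n).
Proof.
move=> bf; elim: n => [|n IHn]; first exact: bounded_measurable_cst.
by under eq_fun do rewrite exprS; exact: bounded_measurableM.
Qed.

Lemma bounded_measurable_norm f :
  bounded_measurable f -> bounded_measurable (fun x => `|f x|).
Proof.
move=> [mf [M fM]]; split; first exact: measurableT_comp.
by exists M => x; rewrite normr_id.
Qed.

Lemma bounded_measurable_max f g :
  bounded_measurable f -> bounded_measurable g ->
  bounded_measurable (fun x => Num.max (f x) (g x)).
Proof.
move=> [mf [M fM]] [mg [N gN]]; split; first exact: measurable_maxr.
by exists (Num.max M N) => x; case: (leP (f x) (g x)) => _;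
  rewrite le_max ?fM ?gN ?orbT.
Qed.

Lemma bounded_measurable_sign f : bounded_measurable f ->
  bounded_measurable (fun x => if 0 <= f x then 1 else -1).
Proof.
move=> [mf _]; split; last first.
  by exists 1 => x; case: ifP => _; rewrite ?normrN normr1.
by apply: measurable_fun_ifT => //; exact: measurable_fun_ler.
Qed.

Lemma bounded_measurable_sum (I : Type) (r : seq I) (Q : pred I)
    (F : I -> T -> R) :
  (forall i, bounded_measurable (F i)) ->
  bounded_measurable (fun x => \sum_(i <- r | Q i) F i x).
Proof.
move=> bF; elim: r => [|i r IHr].
  by under eq_fun do rewrite big_nil; exact: bounded_measurable_cst.
under eq_fun do rewrite big_cons.
by case: (Q i) => //; exact: bounded_measurableD.
Qed.

Variable P : probability T R.

Lemma bounded_measurable_integrable f :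
  bounded_measurable f -> P.-integrable setT (EFin \o f).
Proof.
move=> [mf [M fM]]; apply: measurable_bounded_integrable => //.
  by rewrite [ltLHS]probability_setT ltry.
by exists M; split => //= N MN x _; exact/ltW/(le_lt_trans (fM x)).
Qed.

Definition mean_of f : R := Rintegral P setT f.

Lemma integral_mean_of f :
  bounded_measurable f -> (\int[P]_x (f x)%:E = (mean_of f)%:E)%E.
Proof.
move=> /bounded_measurable_integrable bf.
by rewrite fineK//; exact: integrable_fin_num.
Qed.

Lemma mean_of_cst (c : R) : mean_of (fun=> c) = c.
Proof.
by rewrite /mean_of Rintegral_cst// [X in fine X]probability_setT mulr1.
Qed.

Lemma mean_ofD f g : bounded_measurable f -> bounded_measurable g ->
  mean_of (fun x => f x + g x) = mean_of f + mean_of g.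
Proof.
by move=> bf bg; apply: RintegralD => //; exact: bounded_measurable_integrable.
Qed.

Lemma mean_ofB f g : bounded_measurable f -> bounded_measurable g ->
  mean_of (fun x => f x - g x) = mean_of f - mean_of g.
Proof.
by move=> bf bg; apply: RintegralB => //; exact: bounded_measurable_integrable.
Qed.

Lemma mean_ofZ (c : R) f : bounded_measurable f ->
  mean_of (fun x => c * f x) = c * mean_of f.
Proof.
by move=> bf; apply: RintegralZl => //; exact: bounded_measurable_integrable.
Qed.

Lemma mean_of_sum (I : Type) (r : seq I) (F : I -> T -> R) :
  (forall i, bounded_measurable (F i)) ->
  mean_of (fun x => \sum_(i <- r) F i x) = \sum_(i <- r) mean_of (F i).
Proof.
move=> bF; elim: r => [|i r IHr].
  by under eq_fun do rewrite big_nil; rewrite big_nil mean_of_cst.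
under eq_fun do rewrite big_cons.
by rewrite big_cons mean_ofD ?IHr//; exact: bounded_measurable_sum.
Qed.

Lemma eq_mean_of (A : set T) f g : measurable A -> P A = 1%E ->
  bounded_measurable f -> bounded_measurable g ->
  (forall x, A x -> f x = g x) -> mean_of f = mean_of g.
Proof.
move=> mA PA [mf _] [mg _] fg; congr fine.
apply: ae_eq_integral => //; try exact/measurable_EFinP.
exists (~` A); split; first exact: measurableC.
  by have := probability_setC P mA; rewrite PA subee.
by move=> x /= h Ax; apply: h => _; rewrite fg.
Qed.

(** Replacing [g] by [max f g], which agrees with [g] on [A], turns the almost sure comparison into
    a pointwise one. *)
Lemma le_mean_of (A : set T) f g : measurable A -> P A = 1%E ->
  bounded_measurable f -> bounded_measurable g ->
  (forall x, A x -> f x <= g x) -> mean_of f <= mean_of g.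
Proof.
move=> mA PA bf bg fg.
have bfg := bounded_measurable_max bf bg.
have -> : mean_of g = mean_of (fun x => Num.max (f x) (g x)).
  by apply: (eq_mean_of mA PA) => // x Ax; apply/esym/max_idPr/fg.
apply: le_Rintegral => //; try exact: bounded_measurable_integrable.
by move=> x _; rewrite le_max lexx.
Qed.

Lemma normr_mean_of f (M : R) : bounded_measurable f ->
  (forall x, `|f x| <= M) -> `|mean_of f| <= M.
Proof.
move=> bf fM; rewrite ler_norml -(mean_of_cst (- M)) -{2}(mean_of_cst M).
by apply/andP; split; apply: (le_mean_of measurableT (probability_setT P));
  rewrite //; try exact: bounded_measurable_cst; move=> x _;
  have := fM x; rewrite ler_norml => /andP[].
Qed.

End bounded_measurable.

Lemma bounded_measurable_comp d d' (T : measurableType d)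
    (S : measurableType d') (R : realType) (h : S -> T) (f : T -> R) :
  measurable_fun setT h -> bounded_measurable f ->
  bounded_measurable (fun x => f (h x)).
Proof.
move=> mh [mf [M fM]]; split; first exact: (measurableT_comp mf mh).
by exists M => x; exact: fM.
Qed.

(** * Moments of sums of i.i.d. samples *)

Section iid_moments.
Context d (T : measurableType d) (R : realType) (mu : probability T R).

Lemma bounded_measurable_cons n (f : n.+1.-tuple T -> R) x :
  bounded_measurable f -> bounded_measurable (fun s => f (cons_pair (x, s))).
Proof.
move=> bf.
apply: (bounded_measurable_comp (h := fun s => cons_pair (x, s))) => //.
apply: (@measurableT_comp _ _ _ _ _ _ (@cons_pair _ T n)).
  exact: measurable_cons_pair.
exact: pair1_measurable.
Qed.

(** Fubini on the first sample; this drives the inductions on the sample size. *)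
Lemma mean_of_iidS n (f : n.+1.-tuple T -> R) : bounded_measurable f ->
  mean_of (iid_power mu n.+1) f =
  mean_of mu (fun x =>
    mean_of (iid_power mu n) (fun s => f (cons_pair (x, s)))).
Proof.
move=> bf.
have bz : bounded_measurable (fun z : T * n.-tuple T => f (cons_pair z)).
  exact: (bounded_measurable_comp (h := @cons_pair _ T n)).
have iz := bounded_measurable_integrable (mu \x iid_power mu n)%E bz.
congr fine => /=.
rewrite integral_distribution//; last by apply/measurable_EFinP; case: bf.
rewrite -(integral12_prod_meas1 iz).
apply: eq_integral => x _.
by rewrite /fubini_F -integral_mean_of//; exact: bounded_measurable_cons.
Qed.

Lemma bounded_measurable_tnth n (i : 'I_n) (f : T -> R) :
  bounded_measurable f ->
  bounded_measurable (fun s : n.-tuple T => f (tnth s i)).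
Proof.
move=> bf.
apply: (bounded_measurable_comp (h := fun s : n.-tuple T => tnth s i)) => //.
exact: measurable_tnth.
Qed.

(** Independence in the only form required: [h] ignores sample [i], so averaging over that sample
    alone already gives 0. First samples are peeled off until [i] itself comes first. *)
Lemma mean_of_centered_tnth n (h : n.-tuple T -> R) (f : T -> R) (i : 'I_n) :
  bounded_measurable h -> bounded_measurable f -> mean_of mu f = 0 ->
  (forall s s', (forall j, j != i -> tnth s j = tnth s' j) -> h s = h s') ->
  mean_of (iid_power mu n) (fun s => h s * f (tnth s i)) = 0.
Proof.
elim: n h i => [h []//|n IHn h i bh bf f0 hi].
rewrite mean_of_iidS; last exact/bounded_measurableM/bounded_measurable_tnth.
case: (unliftP ord0 i) hi => [j|] -> hi.
  rewrite -[RHS](mean_of_cst mu 0); congr mean_of; apply/funext => x.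
  under eq_fun do rewrite tnthS.
  apply: (IHn (fun s => h (cons_pair (x, s)))) => //.
    exact: bounded_measurable_cons.
  move=> s s' ss'; apply: hi => k; case: (unliftP ord0 k) => [l|] -> lj.
    by rewrite !tnthS ss'//; apply: contra lj => /eqP ->.
  by rewrite !tnth0.
pose c x := mean_of (iid_power mu n) (fun s => h (cons_pair (x, s))).
transitivity (mean_of mu (fun x => c x * f x)).
  congr mean_of; apply/funext => x.
  under eq_fun do rewrite tnth0 mulrC.
  rewrite [RHS]mulrC.
  exact: (mean_ofZ _ (f x) (bounded_measurable_cons x bh)).
(* The inner mean [c] is constant because [h] ignores the first sample; a reference point [x0] names
   its value, and on an empty [T] any two functions agree. *)
have [[x0 _]|T0] := pselect (exists x : T, True); last first.
  rewrite -[RHS](mean_of_cst mu 0); congr mean_of; apply/funext => x.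
  by case: T0; exists x.
have cE x : c x = c x0.
  congr mean_of; apply/funext => s; apply: hi => k.
  by case: (unliftP ord0 k) => [l|] ->; rewrite ?eqxx// !tnthS.
by under eq_fun do rewrite cE; rewrite (mean_ofZ _ _ bf) f0 mulr0.
Qed.

Variable f : T -> R.
Hypotheses (bf : bounded_measurable f) (f0 : mean_of mu f = 0).

Let S n (s : n.-tuple T) := \sum_(i < n) f (tnth s i).

Lemma bounded_measurable_sum_tnth n : bounded_measurable (@S n).
Proof.
by apply: bounded_measurable_sum => i; exact: bounded_measurable_tnth.
Qed.

Let bS := bounded_measurable_sum_tnth.

Lemma sum_tnth_cons n x (s : n.-tuple T) : S (cons_pair (x, s)) = f x + S s.
Proof.
by rewrite /S big_ord_recl tnth0; under eq_bigr do rewrite tnthS.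
Qed.

Let SE := sum_tnth_cons.

Lemma mean_of_sum_tnth n : mean_of (iid_power mu n) (@S n) = 0.
Proof.
rewrite mean_of_sum => [|i]; last exact: bounded_measurable_tnth.
rewrite big1// => i _; under eq_fun do rewrite -[f _]mul1r.
by apply: mean_of_centered_tnth => //; exact: bounded_measurable_cst.
Qed.

Lemma mean_of_sum_tnth_sqr n :
  mean_of (iid_power mu n) (fun s => S s ^+ 2) =
  n%:R * mean_of mu (fun x => f x ^+ 2).
Proof.
elim: n => [|n IHn].
  by under eq_fun do rewrite /S big_ord0 expr0n; rewrite mean_of_cst mul0r.
rewrite mean_of_iidS; last exact: bounded_measurableX.
have bf2 := bounded_measurableX 2 bf.
have bS2 := bounded_measurableX 2 (bS n).
transitivity (mean_of mu (fun x =>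
    f x ^+ 2 + n%:R * mean_of mu (fun x => f x ^+ 2))).
  congr mean_of; apply/funext => x.
  under eq_fun do rewrite SE sqrrD -mulrnAl.
  have b1 := bounded_measurableZ (f x *+ 2) (bS n).
  have b2 := bounded_measurableD
    (bounded_measurable_cst (n.-tuple T) (f x ^+ 2)) b1.
  rewrite mean_ofD// mean_ofD//; last exact: bounded_measurable_cst.
  by rewrite mean_of_cst (mean_ofZ _ _ (bS n)) mean_of_sum_tnth IHn mulr0 addr0.
rewrite mean_ofD ?mean_of_cst//; last exact: bounded_measurable_cst.
by rewrite -nat1r; ring.
Qed.

(** In the expansion of [(f x + S s) ^+ 4] the terms of odd degree in [f x] have mean zero. The term
    [6 * f x ^+ 2 * S s ^+ 2] adds [6 * n * v ^+ 2] at each step, which sums to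
    [3 * n * (n - 1) * v ^+ 2]. *)
Lemma mean_of_sum_tnth_pow4 n :
  mean_of (iid_power mu n) (fun s => S s ^+ 4) =
  n%:R * mean_of mu (fun x => f x ^+ 4) +
  3 * n%:R * (n%:R - 1) * mean_of mu (fun x => f x ^+ 2) ^+ 2.
Proof.
elim: n => [|n IHn].
  under eq_fun do rewrite /S big_ord0 expr0n.
  by rewrite mean_of_cst !(mul0r, mulr0, addr0).
rewrite mean_of_iidS; last exact: bounded_measurableX.
have bfk k := bounded_measurableX k bf.
have bSk k := bounded_measurableX k (bS n).
set v := mean_of mu (fun x => f x ^+ 2).
(* The third moment stays unevaluated: it only multiplies the mean of [f], which is 0. *)
set m3 := mean_of (iid_power mu n) (fun s => S s ^+ 3).
transitivity (mean_of mu (fun x => f x ^+ 4 + (6 * (n%:R * v)) * f x ^+ 2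
    + (4 * m3) * f x + mean_of (iid_power mu n) (fun s => S s ^+ 4))).
  congr mean_of; apply/funext => x.
  transitivity (mean_of (iid_power mu n) (fun s =>
      f x ^+ 4 + ((4 * f x ^+ 3) * S s + ((6 * f x ^+ 2) * S s ^+ 2 +
      ((4 * f x) * S s ^+ 3 + S s ^+ 4))))).
    by congr mean_of; apply/funext => s; rewrite SE; ring.
  have b1 := bounded_measurableD
    (bounded_measurableZ (4 * f x) (bSk 3)) (bSk 4).
  have b2 := bounded_measurableD
    (bounded_measurableZ (6 * f x ^+ 2) (bSk 2)) b1.
  have b3 := bounded_measurableD
    (bounded_measurableZ (4 * f x ^+ 3) (bS n)) b2.
  rewrite mean_ofD//; last exact: bounded_measurable_cst.
  rewrite mean_ofD//; last exact/bounded_measurableZ/bS.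
  rewrite mean_ofD//; last exact/bounded_measurableZ/bSk.
  rewrite mean_ofD//; last exact/bounded_measurableZ/bSk.
  rewrite mean_of_cst (mean_ofZ _ _ (bS n)) (mean_ofZ _ _ (bSk 2)).
  rewrite (mean_ofZ _ _ (bSk 3)).
  rewrite mean_of_sum_tnth mean_of_sum_tnth_sqr -/v -/m3.
  ring.
have b1 := bounded_measurableD
  (bfk 4) (bounded_measurableZ (6 * (n%:R * v)) (bfk 2)).
have b2 := bounded_measurableD b1 (bounded_measurableZ (4 * m3) bf).
rewrite mean_ofD//; last exact: bounded_measurable_cst.
rewrite mean_ofD//; last exact: bounded_measurableZ.
rewrite mean_ofD//; last exact/bounded_measurableZ/bfk.
rewrite mean_of_cst (mean_ofZ _ _ bf) (mean_ofZ _ _ (bfk 2)) f0 IHn -/v -nat1r.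
ring.
Qed.

End iid_moments.

(** * Doob's L2 inequality *)

Section running_max.
Context (R : realType).
Implicit Types x y : nat -> R.

Fixpoint running_max x k : R :=
  if k is k'.+1 then Num.max (running_max x k') `|x k| else `|x 0%N|.

Lemma le_running_max x i k : (i <= k)%N -> `|x i| <= running_max x k.
Proof.
elim: k => [|k IHk]; first by rewrite leqn0 => /eqP ->.
rewrite leq_eqVlt => /predU1P[->|ik] /=; first by rewrite le_max lexx orbT.
by rewrite le_max IHk.
Qed.

Lemma running_max_le x k (M : R) :
  (forall i, (i <= k)%N -> `|x i| <= M) -> running_max x k <= M.
Proof.
elim: k => [|k IHk] xM /=; first exact: xM.
by rewrite ge_max xM// IHk// => i ik; rewrite xM// leqW.
Qed.

Lemma running_max_ge0 x k : 0 <= running_max x k.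
Proof. exact: le_trans (le_running_max x (leq0n k)). Qed.

Lemma eq_running_max x y k :
  (forall i, (i <= k)%N -> x i = y i) -> running_max x k = running_max y k.
Proof.
elim: k => [|k IHk] xy /=; first by rewrite xy.
by rewrite xy// IHk// => i ik; rewrite xy// leqW.
Qed.

(** The weight of the martingale transform below. It depends on the path up to time [k] only, and
    its sign makes the weighted increment at most [running_max x k] times the increment of [|x|]. *)
Definition signed_max x k : R :=
  running_max x k * (if 0 <= x k then 1 else -1).

(* The pathwise form of Doob's L2 inequality: if x is the path of a martingale,
   the sum is a martingale transform, hence has mean zero. *)
Lemma running_max_sqr_le x n :
  running_max x n ^+ 2 <=
  4 * x n ^+ 2 - 4 * \sum_(k < n) signed_max x k * (x k.+1 - x k).
Proof.
(* This form survives induction: if the maximum [s] stays, both sides are compared through [gk]; if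
   it rises to [s'], the slack gains [(s' - s) ^+ 2]. The square [(s - 2 * y) ^+ 2] removes the
   mixed product at the end. *)
have inv k : running_max x k ^+ 2 <= 2 * running_max x k * `|x k| -
    2 * \sum_(i < k) signed_max x i * (x i.+1 - x i).
  elim: k => [|k IHk]; first by rewrite big_ord0 /= expr2; nra.
  rewrite big_ord_recr /=; set s := running_max x k in IHk *.
  set S := \sum_(i < k) _ in IHk *.
  have s0 : 0 <= s := running_max_ge0 x k.
  have gk : signed_max x k * (x k.+1 - x k) <= s * (`|x k.+1| - `|x k|).
    rewrite /signed_max -/s -mulrA ler_wpM2l//.
    have := ler_norm (x k.+1); have := ler_norm (- x k.+1); rewrite normrN.
    case: ifPn => [/ger0_norm ->|]; first by lra.
    by rewrite -ltNge => /ltr0_norm ->; lra.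
  by case: (leP s `|x k.+1|) => h; nra.
have {}inv := inv n.
rewrite -[x n ^+ 2]real_normK ?num_real//.
set s := running_max x n in inv *; set y := `|x n| in inv *.
have := sqr_ge0 (s - 2 * y); nra.
Qed.

End running_max.

Section maximal_inequality.
Context d (T : measurableType d) (R : realType) (mu : probability T R).

Lemma bounded_measurable_running_max d' (S : measurableType d')
    (x : nat -> S -> R) k : (forall i, bounded_measurable (x i)) ->
  bounded_measurable (fun s => running_max (x ^~ s) k).
Proof.
move=> bx; elim: k => [|k IHk] /=; first exact: bounded_measurable_norm.
exact/bounded_measurable_max/bounded_measurable_norm.
Qed.

Lemma iid_power_box n (A : set T) : measurable A -> mu A = 1%E ->
  measurable [set s : n.-tuple T | forall i, A (tnth s i)] /\
  iid_power mu n [set s | forall i, A (tnth s i)] = 1%E.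
Proof.
move=> mA muA; split; first exact: (measurable_box (A := fun=> A)).
by rewrite (iid_powerE mu (A := fun=> A))// big1.
Qed.

Variables (f : nat -> T -> R) (c : nat -> R) (A : set T).
Hypotheses (bf : forall k, bounded_measurable (f k))
  (f0 : forall k, mean_of mu (f k) = 0) (mA : measurable A) (muA : mu A = 1%E).
(* A sample that moves at time k has the deterministic past c. *)
Hypothesis fc :
  forall k l x, A x -> f k.+1 x != f k x -> (l <= k)%N -> f l x = c l.

Let m n k (s : n.-tuple T) := \sum_(i < n) f k (tnth s i).

(* At a time when the i-th sample moves, m' i agrees with m up to that time, but
   does not depend on that sample: by independence, the increment of the i-th
   sample in the martingale transform has mean zero. *)
Let m' n (i : 'I_n) k (s : n.-tuple T) :=
  c k + \sum_(j < n | j != i) f k (tnth s j).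

Let bm n k : bounded_measurable (@m n k).
Proof. exact: bounded_measurable_sum_tnth. Qed.

Let bm' n i k : bounded_measurable (@m' n i k).
Proof.
apply: bounded_measurableD; first exact: bounded_measurable_cst.
by apply: bounded_measurable_sum => j; exact: bounded_measurable_tnth.
Qed.

Let bounded_measurable_signed_max d' (S : measurableType d')
    (x : nat -> S -> R) k :
  (forall i, bounded_measurable (x i)) ->
  bounded_measurable (fun s => signed_max (x ^~ s) k).
Proof.
move=> bx; apply: bounded_measurableM.
  exact: bounded_measurable_running_max.
exact: bounded_measurable_sign.
Qed.

(** Averaging the pathwise inequality gives the bound once the transform term has mean zero. That
    term is split over samples, and independence replaces conditional expectations. *)
Lemma mean_of_running_max_sqr n N :
  mean_of (iid_power mu n) (fun s =>
    running_max (fun k => \sum_(i < n) f k (tnth s i)) N ^+ 2) <=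
  4 * n%:R * mean_of mu (fun x => f N x ^+ 2).
Proof.
have [mB PB] := iid_power_box n mA muA.
(* The weight is computed from [m'] instead of [m], so that it does not involve sample [i]. *)
pose g (k : 'I_N) (i : 'I_n) (s : n.-tuple T) :=
  signed_max ((@m' n i) ^~ s) k * (f k.+1 (tnth s i) - f k (tnth s i)).
have bg k i : bounded_measurable (g k i).
  apply: bounded_measurableM; first exact: bounded_measurable_signed_max.
  by apply: bounded_measurableB; exact: bounded_measurable_tnth.
have g0 k i : mean_of (iid_power mu n) (g k i) = 0.
  apply: (mean_of_centered_tnth (f := fun x => f k.+1 x - f k x)).
  - exact: bounded_measurable_signed_max.
  - exact: bounded_measurableB.
  - by rewrite mean_ofB// !f0 subrr.
  - move=> s s' ss'; congr (signed_max _ _); apply/funext => l.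
    by congr (_ + _); apply: eq_bigr => j ji; rewrite ss'.
have bG : bounded_measurable (fun s => \sum_(k < N) \sum_(i < n) g k i s).
  by apply: bounded_measurable_sum => k; exact: bounded_measurable_sum.
have bM : bounded_measurable (fun s : n.-tuple T => m N s ^+ 2).
  exact: bounded_measurableX.
have -> : 4 * n%:R * mean_of mu (fun x => f N x ^+ 2) =
    mean_of (iid_power mu n)
      (fun s => 4 * m N s ^+ 2 - 4 * \sum_(k < N) \sum_(i < n) g k i s).
  rewrite mean_ofB; [|exact: bounded_measurableZ..].
  rewrite (mean_ofZ _ _ bM) (mean_ofZ _ _ bG) mean_of_sum_tnth_sqr//.
  rewrite mean_of_sum => [|k]; last exact: bounded_measurable_sum.
  rewrite [X in _ - 4 * X]big1 ?mulr0 ?subr0 ?mulrA// => k _.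
  by rewrite mean_of_sum// big1.
apply: (le_mean_of mB PB).
- apply: bounded_measurableX.
  exact: (bounded_measurable_running_max (x := @m n)).
- by apply: bounded_measurableB; exact: bounded_measurableZ.
move=> s As; apply: (le_trans (running_max_sqr_le _ _)).
rewrite lerD2l lerN2 ler_wpM2l// ler_sum// => k _.
rewrite -sumrB mulr_sumr ler_sum// => i _.
(* A sample at rest contributes 0 under either weight; for a moving one [fc] identifies [m] with
   [m'] up to time [k]. *)
have [fk|fk] := eqVneq (f k.+1 (tnth s i)) (f k (tnth s i)).
  by rewrite /g fk subrr !mulr0.
have mm' l : (l <= k)%N -> m l s = m' i l s.
  by move=> lk; rewrite /m (bigD1 i)//= (fc (As i) fk lk).
by rewrite /g /signed_max -(eq_running_max (x := (@m n) ^~ s) mm') -mm'.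
Qed.

End maximal_inequality.

(** * The coupling by a uniform threshold *)

Section threshold_law.
Context (R : realType).

Definition threshold (p : nat -> R) (u : measurableTypeR R) : binseq :=
  fun j => u <= p j.

Lemma measurable_threshold p : measurable_fun setT (threshold p).
Proof.
apply: (@measurability _ _ _ binseq _ _ (\bigcup_j preimage_set_system setT
  (fun x : nat -> bool => x j) measurable)) => //.
move=> _ [_ [j _ [B mB <-]] <-].
rewrite (_ : _ `&` _ =
    setT `&` (fun u : measurableTypeR R => u <= p j) @^-1` B).
  by apply: measurable_fun_ler.
by apply/seteqP; split => u /=; [move=> [_ []]|move=> [_]].
Qed.

HB.instance Definition _ p :=
  isMeasurableFun.Build _ _ _ _ (threshold p) (@measurable_threshold p).

Definition threshold_law (p : nat -> R) : probability binseq R :=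
  distribution (uniform_prob (@ltr01 R)) (threshold p).

Lemma bounded_measurable_coordinate j : bounded_measurable (@coordinate R j).
Proof.
split; first exact: measurable_coordinate.
by exists 1 => x; rewrite /coordinate; case: (x j); rewrite ?normr0 ?normr1.
Qed.

Lemma mean_of_threshold_law p j : 0 <= p j <= 1 ->
  mean_of (threshold_law p) (coordinate R j) = p j.
Proof.
move=> /andP[p0 p1].
have [mc _] := bounded_measurable_coordinate j.
rewrite /mean_of /Rintegral ge0_integral_distribution/=; last 2 first.
- exact/measurable_EFinP.
- by move=> x; rewrite lee_fin ler0n.
rewrite integral_uniform; last 2 first.
- apply/measurable_EFinP.
  by apply: (measurableT_comp mc); exact: measurable_threshold.
- by move=> x; rewrite lee_fin ler0n.
rewrite subr0 invr1 mul1e.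
under eq_integral => u _.
  rewrite (_ : coordinate R j (threshold p u) =
    \1_(`]-oo, p j]%classic : set (measurableTypeR R)) u); last first.
    by rewrite /coordinate /threshold indicE mem_setE in_itv.
  over.
rewrite integral_indic//= (_ : _ `&` _ = `[0, p j]%classic).
  rewrite lebesgue_measure_itv/= lte_fin lt_neqAle p0 andbT.
  by case: eqP => /= [<-//|_]; rewrite subr0.
apply/seteqP; split => u /=; rewrite !in_itv/=.
  by move=> [-> /andP[->]].
by move=> /andP[-> up]; rewrite up (le_trans up).
Qed.

(** Support of the threshold law. Besides the means, this is all that the upper bounds use about
    it. *)
Definition decreasing_binseq : set binseq := [set x | forall j, x j.+1 -> x j].

Lemma measurable_decreasing_binseq : measurable decreasing_binseq.
Proof.
rewrite (_ : decreasing_binseq =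
    \bigcap_j (setT `&`
      (fun x => coordinate R j.+1 x <= coordinate R j x) @^-1` [set true])).
  apply: bigcapT_measurable => j.
  by apply: measurable_fun_ler => //; exact: measurable_coordinate.
have le_coordinate j (x : binseq) :
    (coordinate R j.+1 x <= coordinate R j x) = (x j.+1 ==> x j).
  by rewrite /coordinate ler_nat; case: (x j.+1); case: (x j).
apply/seteqP; split => x /= h j.
  by move=> _; split => //=; rewrite le_coordinate; apply/implyP/h.
by have [_ /=] := h j I; rewrite le_coordinate => /implyP.
Qed.

Lemma threshold_law_decreasing p : (forall j, p j.+1 <= p j) ->
  threshold_law p decreasing_binseq = 1%E.
Proof.
move=> pd; rewrite -(probability_setT (uniform_prob (@ltr01 R))).
rewrite (_ : setT = threshold p @^-1` decreasing_binseq)//.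
by apply/seteqP; split => u // _ j /= /le_trans; apply.
Qed.

End threshold_law.

(** * Bounds on Delta *)

Section Delta_limit.
Context (R : realType).

Lemma nondecreasing_running_max (y : nat -> R) :
  {homo running_max y : k l / (k <= l)%N >-> k <= l}.
Proof.
move=> k l kl; apply: running_max_le => i ik.
exact/le_running_max/(leq_trans ik).
Qed.

Lemma cvg_running_max (y : nat -> R) (M : R) : (forall j, `|y j| <= M) ->
  running_max y k @[k --> \oo] --> sup [set `|y j| | j in [set: nat]].
Proof.
move=> yM.
have rM k : running_max y k <= M by apply: running_max_le.
have -> : sup [set `|y j| | j in [set: nat]] = sup (range (running_max y)).
  apply/eqP; rewrite eq_le; apply/andP; split; apply: ge_sup.
  - by exists `|y 0%N|; exists 0%N.
  - move=> _ [j _ <-]; apply: (le_trans (le_running_max y (leqnn j))).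
    by apply: ub_le_sup; [exists M => _ [k _ <-]|exists j].
  - by exists (running_max y 0); exists 0%N.
  - move=> _ [k _ <-]; apply: running_max_le => j _.
    by apply: ub_le_sup; [exists M => _ [i _ <-]|exists j].
apply: nondecreasing_cvgn; first exact: nondecreasing_running_max.
by exists M => _ [k _ <-].
Qed.

Lemma bounded_measurable_empirical_mean n j :
  bounded_measurable (fun s : n.-tuple binseq => empirical_mean R s j).
Proof.
apply: bounded_measurableZ; apply: bounded_measurable_sum => i.
exact/bounded_measurable_tnth/bounded_measurable_coordinate.
Qed.

Definition deviation n (mu : probability binseq R) (j : nat)
    (s : n.-tuple binseq) : R :=
  empirical_mean R s j - mean mu j.

Lemma bounded_measurable_deviation n mu j :
  bounded_measurable (@deviation n mu j).
Proof.
apply: bounded_measurableB; first exact: bounded_measurable_empirical_mean.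
exact: bounded_measurable_cst.
Qed.

Lemma coordinate01 j (x : binseq) : 0 <= coordinate R j x <= 1.
Proof. by rewrite /coordinate; case: (x j); rewrite ?lexx ?ler01. Qed.

Lemma empirical_mean01 n (s : n.-tuple binseq) j :
  0 <= empirical_mean R s j <= 1.
Proof.
(* Without samples the empty sum makes the empirical mean 0. *)
rewrite /empirical_mean; case: n s => [|n] s.
  by rewrite big_ord0 mulr0 lexx ler01.
rewrite mulr_ge0 ?invr_ge0//=; last first.
  by apply: sumr_ge0 => i _; have /andP[] := coordinate01 j (tnth s i).
rewrite ler_pdivrMl// mulr1 -[leRHS]mulr1 -[X in X%:R * _]card_ord.
rewrite mulr_natl -sumr_const ler_sum// => i _.
by have /andP[] := coordinate01 j (tnth s i).
Qed.

Lemma meanE (mu : probability binseq R) j :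
  mean mu j = mean_of mu (coordinate R j).
Proof. by rewrite /mean unlock. Qed.

Lemma normr_deviation n (mu : probability binseq R) j (s : n.-tuple binseq) :
  `|deviation mu j s| <= 2.
Proof.
rewrite /deviation (le_trans (ler_normB _ _))// (_ : 2 = 1 + 1)// lerD//.
  by have /andP[e0 e1] := empirical_mean01 s j; rewrite ger0_norm.
rewrite meanE; apply: normr_mean_of; first exact: bounded_measurable_coordinate.
by move=> x; have /andP[c0 c1] := coordinate01 j x; rewrite ger0_norm.
Qed.

(** Monotone convergence along the finite maxima; bounds uniform in the horizon [k] then pass to
    [Delta]. *)
Lemma cvg_Delta n (mu : probability binseq R) :
  (mean_of (iid_power mu n)
    (fun s => running_max (fun j => deviation mu j s) k))%:E
    @[k --> \oo] --> Delta n mu.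
Proof.
have bD k : bounded_measurable
    (fun s : n.-tuple binseq => running_max (fun j => deviation mu j s) k).
  apply: (bounded_measurable_running_max (x := @deviation n mu)).
  exact: bounded_measurable_deviation.
pose g k (s : n.-tuple binseq) :=
  (running_max (fun j => deviation mu j s) k)%:E.
have -> : Delta n mu = (\int[iid_power mu n]_s limn (g ^~ s))%E.
  rewrite /Delta unlock; apply: eq_integral => s _; apply/esym/cvg_lim => //.
  apply: cvg_EFin; first exact: nearW.
  by apply: (@cvg_running_max _ 2) => j; exact: normr_deviation.
under eq_fun do rewrite -integral_mean_of//.
apply: cvg_monotone_convergence => //.
- by move=> k; apply/measurable_EFinP; case: (bD k).
- by move=> k s _; rewrite lee_fin running_max_ge0.
- by move=> s _ k l kl; rewrite lee_fin nondecreasing_running_max.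
Qed.

End Delta_limit.

(** * Lower bound from the first coordinate *)

Section Delta_bounds.
Context (R : realType) (mu : probability binseq R) (p : nat -> R).
Hypotheses (p_ge0 : forall j, 0 <= p j) (p_le : forall j, p j <= 2^-1).
Hypothesis mean_p : forall j, mean_of mu (coordinate R j) = p j.

Let centered j (x : binseq) := coordinate R j x - p j.

Let bounded_measurable_centered j : bounded_measurable (centered j).
Proof.
apply: bounded_measurableB; first exact: bounded_measurable_coordinate.
exact: bounded_measurable_cst.
Qed.

Let mean_of_centered j : mean_of mu (centered j) = 0.
Proof.
rewrite mean_ofB ?mean_of_cst ?mean_p ?subrr//.
  exact: bounded_measurable_coordinate.
exact: bounded_measurable_cst.
Qed.

Let mean_of_centered_sqr j :
  mean_of mu (fun x => centered j x ^+ 2) = p j * (1 - p j).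
Proof.
(* A coordinate takes only the values 0 and 1, so its centred square is affine in it. *)
transitivity (mean_of mu (fun x =>
    (1 - 2 * p j) * coordinate R j x + p j ^+ 2)).
  congr mean_of; apply/funext => x.
  by rewrite /centered /coordinate; case: (x j) => /=;
    rewrite ?mulr1n ?mulr0n; ring.
have bc := bounded_measurable_coordinate R j.
rewrite mean_ofD; [|exact: bounded_measurableZ|exact: bounded_measurable_cst].
by rewrite (mean_ofZ _ _ bc) mean_of_cst mean_p; ring.
Qed.

Let deviationE n j (s : n.-tuple binseq) : (0 < n)%N ->
  deviation mu j s = n%:R^-1 * \sum_(i < n) centered j (tnth s i).
Proof.
move=> n0; rewrite /deviation meanE mean_p /empirical_mean /centered.
rewrite sumrB sumr_const card_ord mulrBr; congr (_ - _).
by rewrite -(mulr_natl (p j)) mulKf// pnatr_eq0 -lt0n.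
Qed.

Let bounded_measurable_max_deviation n k :
  bounded_measurable
    (fun s : n.-tuple binseq => running_max (fun j => deviation mu j s) k).
Proof.
apply: (bounded_measurable_running_max (x := @deviation _ n mu)) => j.
exact: bounded_measurable_deviation.
Qed.

Lemma sqrtr_nat_mul (q : R) n : (0 < n)%N -> 0 <= q ->
  Num.sqrt (q / n%:R) * Num.sqrt (n%:R * q) = q.
Proof.
move=> n0 q0; rewrite -sqrtrM ?divr_ge0//.
have -> : q / n%:R * (n%:R * q) = q ^+ 2 by field; rewrite pnatr_eq0 -lt0n.
by rewrite sqrtr_sqr ger0_norm.
Qed.

(** The second moment bounds the first absolute moment from below as long as the fourth moment is
    controlled. *)
Lemma mean_of_normr_deviation_ge n : (0 < n)%N ->
  16^-1 * Num.min (p 0) (Num.sqrt (p 0 / n%:R)) <=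
  mean_of (iid_power mu n) (fun s => `|deviation mu 0 s|).
Proof.
move=> n0; have nR : 0 < n%:R :> R by rewrite ltr0n.
pose S (s : n.-tuple binseq) := \sum_(i < n) centered 0 (tnth s i).
have bS : bounded_measurable S.
  by apply: bounded_measurable_sum_tnth; exact: bounded_measurable_centered.
set q := p 0; have q0 : 0 <= q := p_ge0 0; have q2 : q <= 2^-1 := p_le 0.
pose m := n%:R * q; have m0 : 0 <= m by rewrite mulr_ge0// ltW.
(* This covers both regimes: [q / sqrt M] is [q] when [m <= 1] and [sqrt (q / n)] otherwise. *)
pose M := Num.max 1 m.
have M1 : 1 <= M by rewrite le_max lexx.
have mM : m <= M by rewrite le_max lexx orbT.
pose r := Num.sqrt M.
have r2 : r ^+ 2 = M by rewrite sqr_sqrtr// (le_trans ler01).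
have r0 : 0 < r by rewrite sqrtr_gt0 (lt_le_trans ltr01).
(* With [l ^+ 2 = 16 * M], the fourth-moment loss [4 * m * M / l ^+ 3] is [m / (4 * l)], half of the
   gain [m / (2 * l)]. *)
pose l := 4 * r; have l0 : 0 < l by rewrite mulr_gt0.
have bS2 := bounded_measurableX 2 bS; have bS4 := bounded_measurableX 4 bS.
have fourth : mean_of mu (fun x => centered 0 x ^+ 4) <= q.
  apply: (le_trans (y := q * (1 - q))); last by nra.
  rewrite -mean_of_centered_sqr.
  apply: (le_mean_of measurableT (probability_setT mu)).
  - exact: bounded_measurableX.
  - exact: bounded_measurableX.
  - move=> x _; have /andP[c0 c1] := coordinate01 R 0 x.
    have : centered 0 x ^+ 2 <= 1 by rewrite /centered -/q; nra.
    by have := sqr_ge0 (centered 0 x); nra.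
have ES2 : m / 2 <= mean_of (iid_power mu n) (fun s => S s ^+ 2).
  rewrite mean_of_sum_tnth_sqr// mean_of_centered_sqr -/q /m -mulrA.
  by rewrite ler_pM2l//; nra.
(* Both [m] and [m ^+ 2] are at most [m * M]. *)
have ES4 : mean_of (iid_power mu n) (fun s => S s ^+ 4) <= 4 * m * M.
  rewrite mean_of_sum_tnth_pow4// mean_of_centered_sqr -/q.
  apply: (le_trans (y := m + 3 * m ^+ 2)); last by nra.
  apply: lerD; first by rewrite ler_pM2l.
  have -> : 3 * n%:R * (n%:R - 1) * (q * (1 - q)) ^+ 2 =
    3 * (m ^+ 2 * (1 - q) ^+ 2 - n%:R * (q * (1 - q)) ^+ 2) by rewrite /m; ring.
  rewrite ler_pM2l// lerBlDr (le_trans (y := m ^+ 2))//.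
    by rewrite ler_piMr ?sqr_ge0//; nra.
  by rewrite lerDl mulr_ge0 ?sqr_ge0// ltW.
have lower : m / (4 * l) <= mean_of (iid_power mu n) (fun s => `|S s|).
  apply: (le_trans (y := l^-1 * mean_of (iid_power mu n) (fun s => S s ^+ 2) -
      l^-1 ^+ 3 * mean_of (iid_power mu n) (fun s => S s ^+ 4))).
    have l2 : l ^+ 2 = 16 * M by rewrite /l exprMn r2; ring.
    apply: (le_trans (y := l^-1 * (m / 2) - l^-1 ^+ 3 * (4 * m * M))).
      rewrite (_ : l^-1 ^+ 3 * (4 * m * M) = l^-1 * (m / 4)).
        rewrite (_ : _ / (4 * l) = l^-1 * (m / 2) - l^-1 * (m / 4))//.
        by field; lra.
      have -> : M = l ^+ 2 / 16 by rewrite l2; field.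
      by field; lra.
    by apply: lerB; rewrite ler_wpM2l// ?exprn_ge0// invr_ge0 ltW.
  rewrite -(mean_ofZ _ _ bS2) -(mean_ofZ _ _ bS4) -mean_ofB; last 2 first.
  - exact: bounded_measurableZ.
  - exact: bounded_measurableZ.
  apply: (le_mean_of measurableT (probability_setT _)).
  - by apply: bounded_measurableB; exact: bounded_measurableZ.
  - exact: bounded_measurable_norm.
  (* t >= t^2 - t^4 for t >= 0 *)
  move=> s _; pose t := `|S s| / l.
  have t0 : 0 <= t by rewrite divr_ge0// ltW.
  have -> : `|S s| = l * t by rewrite /t; field; lra.
  have -> : l^-1 * S s ^+ 2 - l^-1 ^+ 3 * S s ^+ 4 = l * (t ^+ 2 - t ^+ 4).
    have -> : S s ^+ 4 = (S s ^+ 2) ^+ 2 by rewrite -exprM.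
    by rewrite -(real_normK (num_real (S s))) /t; field; lra.
  by rewrite ler_pM2l//; have [t1|t1] := leP t 1; nra.
have -> : mean_of (iid_power mu n) (fun s => `|deviation mu 0 s|) =
    n%:R^-1 * mean_of (iid_power mu n) (fun s => `|S s|).
  rewrite -mean_ofZ; last exact: bounded_measurable_norm.
  congr mean_of; apply/funext => s.
  by rewrite deviationE// normrM ger0_norm// invr_ge0 ltW.
apply: (le_trans (y := n%:R^-1 * (m / (4 * l)))); last first.
  by rewrite ler_wpM2l// invr_ge0 ltW.
have -> : n%:R^-1 * (m / (4 * l)) = 16^-1 * (q / r).
  by rewrite /m /l; field; lra.
rewrite ler_pM2l ?invr_gt0// ler_pdivlMr//.
have [m1|m1] := leP m 1.
  have -> : r = 1 by rewrite /r /M (max_l m1) sqrtr1.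
  by rewrite mulr1 ge_min lexx.
have -> : r = Num.sqrt (n%:R * q) by rewrite /r /M max_r// ltW.
rewrite -[leRHS](sqrtr_nat_mul n0 q0) ler_wpM2r ?sqrtr_ge0//.
by rewrite ge_min lexx orbT.
Qed.

Lemma Delta_ge n : (0 < n)%N ->
  ((16^-1 * Num.min (p 0) (Num.sqrt (p 0 / n%:R)))%:E <= Delta n mu)%E.
Proof.
move=> n0; rewrite -(cvg_lim _ (@cvg_Delta R n mu))//.
apply: lime_ge; first by apply/cvg_ex; eexists; exact: cvg_Delta.
apply: nearW => k; rewrite lee_fin.
apply: (le_trans (mean_of_normr_deviation_ge n0)).
apply: (le_mean_of measurableT (probability_setT _)).
- exact/bounded_measurable_norm/bounded_measurable_deviation.
- exact: bounded_measurable_max_deviation.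
by move=> s _; exact: (le_running_max (fun j => deviation mu j s)).
Qed.

Lemma Delta_le n (M : R) :
  (forall k, mean_of (iid_power mu n)
    (fun s => running_max (fun j => deviation mu j s) k) <= M) ->
  (Delta n mu <= M%:E)%E.
Proof.
move=> DM; rewrite -(cvg_lim _ (@cvg_Delta R n mu))//.
apply: lime_le; first by apply/cvg_ex; eexists; exact: cvg_Delta.
by apply: nearW => k; rewrite lee_fin.
Qed.

(** * Upper bounds for laws on decreasing sequences *)

Hypotheses (p_decr : forall j, p j.+1 <= p j)
  (mu_decr : mu decreasing_binseq = 1%E).

Let decreasing_binseqW (x : binseq) i j :
  decreasing_binseq x -> (i <= j)%N -> x j -> x i.
Proof.
move=> dx /subnK <-; elim: (j - i)%N => // k IHk.
by rewrite addSn => /dx/IHk.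
Qed.

Let p_homo i j : (i <= j)%N -> p j <= p i.
Proof.
move=> /subnK <-; elim: (j - i)%N => // k IHk.
by rewrite addSn (le_trans (p_decr _)).
Qed.

(** On decreasing samples the first empirical mean dominates all the others, so every deviation is
    at most this mean plus [p 0]. *)
Lemma Delta_le_mean n : (Delta n mu <= (2 * p 0)%:E)%E.
Proof.
have [mB PB] := iid_power_box n (@measurable_decreasing_binseq R) mu_decr.
apply: Delta_le => k.
have be := bounded_measurable_empirical_mean R n 0.
apply: (le_trans (y := mean_of (iid_power mu n)
    (fun s => empirical_mean R s 0 + p 0))).
  apply: (le_mean_of mB PB); first exact: bounded_measurable_max_deviation.
    by apply: bounded_measurableD => //; exact: bounded_measurable_cst.
  move=> s ds; apply: running_max_le => j _.
  have /andP[e0 _] := empirical_mean01 R s j.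
  have e_le : empirical_mean R s j <= empirical_mean R s 0.
    rewrite /empirical_mean ler_wpM2l ?invr_ge0// ler_sum// => i _.
    rewrite /coordinate ler_nat; case: (boolP (tnth s i j)) => // sj.
    by rewrite (decreasing_binseqW (ds i) (leq0n j)).
  rewrite /deviation meanE mean_p.
  have := p_ge0 j; have := p_homo (leq0n j); move=> pj pj0.
  by rewrite ler_norml; apply/andP; split; lra.
rewrite mean_ofD//; last exact: bounded_measurable_cst.
rewrite mean_of_cst mulr2n mulrDl mul1r lerD2r.
have bc := bounded_measurable_coordinate R 0.
rewrite mean_ofZ; last first.
  by apply: bounded_measurable_sum => i; exact: bounded_measurable_tnth.
have -> : mean_of (iid_power mu n)
    (fun s => \sum_(i < n) coordinate R 0 (tnth s i)) = n%:R * p 0.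
  transitivity (mean_of (iid_power mu n)
      (fun s => \sum_(i < n) centered 0 (tnth s i) + n%:R * p 0)).
    congr mean_of; apply/funext => s.
    by rewrite /centered sumrB sumr_const card_ord -(mulr_natl (p 0)) subrK.
  have bS := bounded_measurable_sum_tnth (bounded_measurable_centered 0) n.
  rewrite mean_ofD//; last exact: bounded_measurable_cst.
  by rewrite mean_of_cst mean_of_sum_tnth// add0r.
case: n {be mB PB} => [|n]; first by rewrite mul0r mulr0.
by rewrite mulKf.
Qed.

(** Doob's inequality for the normalised sums, run through the indices backwards; AM-GM then passes
    from the second moment to the first. *)
Lemma Delta_le_sqrt n : (0 < n)%N -> 0 < p 0 ->
  (Delta n mu <= (5 * Num.sqrt (p 0 / n%:R))%:E)%E.
Proof.
move=> n0 p0; have nR : 0 < n%:R :> R by rewrite ltr0n.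
have [mB PB] := iid_power_box n (@measurable_decreasing_binseq R) mu_decr.
apply: Delta_le => N.
have p1 j : 0 < 1 - p j by have := p_le j; lra.
(* Time runs from p N up to p 0, along which the martingale moves forward. *)
pose f k (x : binseq) := (1 - p (N - k))^-1 * centered (N - k) x.
have bf k : bounded_measurable (f k) by exact: bounded_measurableZ.
have f0 k : mean_of mu (f k) = 0.
  rewrite (mean_ofZ _ _ (bounded_measurable_centered _)).
  by rewrite mean_of_centered mulr0.
(* The normalisation makes [f] equal to 1 wherever the coordinate is 1. A sample already at 1 stays
   at 1, hence never moves; one that moves was at 0 at all earlier times. *)
have fc k l x : decreasing_binseq x -> f k.+1 x != f k x -> (l <= k)%N ->
    f l x = - ((1 - p (N - l))^-1 * p (N - l)).
  move=> dx fk lk.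
  have xk : ~~ x (N - k)%N.
    apply: contra fk => xk.
    have xk1 : x (N - k.+1)%N.
      by apply: decreasing_binseqW xk => //; rewrite leq_sub2l.
    by rewrite /f /centered /coordinate xk xk1 !mulVf// gt_eqF.
  have xl : x (N - l)%N = false.
    apply: contraNF xk; apply: decreasing_binseqW => //; exact: leq_sub2l.
  by rewrite /f /centered /coordinate xl sub0r mulrN.
pose W (s : n.-tuple binseq) :=
  running_max (fun k => \sum_(i < n) f k (tnth s i)) N.
have bW : bounded_measurable W.
  apply: (bounded_measurable_running_max
    (x := fun k (s : n.-tuple binseq) => \sum_(i < n) f k (tnth s i))) => k.
  exact: bounded_measurable_sum_tnth.
(* The terminal variance is [p 0 / (1 - p 0)], at most [2 * p 0] since [p 0 <= 1/2]. *)
have EW : mean_of (iid_power mu n) (fun s => W s ^+ 2) <= 8 * n%:R * p 0.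
  apply: (le_trans (mean_of_running_max_sqr bf f0
    (@measurable_decreasing_binseq R) mu_decr fc n N)).
  rewrite [leRHS](_ : _ = 4 * n%:R * (2 * p 0)); last by ring.
  rewrite ler_wpM2l ?mulr_ge0 ?ler0n//.
  have -> : mean_of mu (fun x => f N x ^+ 2) =
      (1 - p 0)^-1 ^+ 2 * mean_of mu (fun x => centered 0 x ^+ 2).
    rewrite -(mean_ofZ _ _
      (bounded_measurableX 2 (bounded_measurable_centered 0))).
    by congr mean_of; apply/funext => x; rewrite /f subnn exprMn.
  rewrite mean_of_centered_sqr exprVn ler_pdivrMl ?exprn_gt0//.
  rewrite -subr_ge0 [leRHS](_ : _ = p 0 * (1 - p 0) * (1 - 2 * p 0));
    last by ring.
  have h : 0 <= 1 - 2 * p 0 by have := p_le 0; lra.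
  exact: mulr_ge0 (mulr_ge0 (ltW p0) (ltW (p1 0))) h.
pose l := Num.sqrt (p 0 / n%:R).
have l0 : 0 < l by rewrite sqrtr_gt0 divr_gt0.
have l2 : l ^+ 2 = p 0 / n%:R by rewrite sqr_sqrtr// ltW// divr_gt0.
have bW2 := bounded_measurableX 2 bW.
(* Chosen so that [a * W s ^+ 2] is the AM-GM term [w ^+ 2 / (2 * l)] with [w = W s / n]. *)
pose a : R := (2 * l * n%:R ^+ 2)^-1.
have a0 : 0 < a by rewrite invr_gt0 !mulr_gt0// exprn_gt0.
apply: (le_trans (y := mean_of (iid_power mu n)
    (fun s => a * W s ^+ 2 + l / 2))).
  apply: (le_mean_of mB PB); first exact: bounded_measurable_max_deviation.
    apply: bounded_measurableD; first exact: bounded_measurableZ.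
    exact: bounded_measurable_cst.
  move=> s ds; apply: (le_trans (y := n%:R^-1 * W s)).
    apply: running_max_le => j jN; rewrite deviationE// normrM.
    rewrite ger0_norm ?invr_ge0 ?(ltW nR)// ler_pM2l ?invr_gt0//.
    (* Index [j] is visited at time [N - j], and the normalising factor there is at least 1. *)
    apply: (le_trans _ (le_running_max _ (leq_subr j N))).
    rewrite /f subKn// -mulr_sumr normrM ler_peMl//.
    rewrite ger0_norm ?invr_ge0 ?(ltW (p1 _))//.
    by rewrite invf_ge1//; have := p_ge0 j; lra.
  have -> : a * W s ^+ 2 = (n%:R^-1 * W s) ^+ 2 / (2 * l).
    by rewrite /a; field; rewrite !gt_eqF.
  (* AM-GM: w <= w^2 / (2 l) + l / 2 *)
  set w := _ * W s; rewrite -subr_ge0.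
  have -> : w ^+ 2 / (2 * l) + l / 2 - w = (w - l) ^+ 2 / (2 * l).
    by field; rewrite gt_eqF.
  by rewrite divr_ge0 ?sqr_ge0// mulr_ge0// ltW.
rewrite mean_ofD; [|exact: bounded_measurableZ|exact: bounded_measurable_cst].
rewrite mean_of_cst (mean_ofZ _ _ bW2).
apply: (le_trans (y := a * (8 * n%:R * p 0) + l / 2)).
  by rewrite lerD2r ler_pM2l.
rewrite -/l; have -> : p 0 = n%:R * l ^+ 2 by rewrite l2; field; rewrite gt_eqF.
(* The total [4 * l + l / 2] is below [5 * l]. *)
have -> : a * (8 * n%:R * (n%:R * l ^+ 2)) = 4 * l.
  by rewrite /a; field; rewrite !gt_eqF.
by lra.
Qed.

End Delta_bounds.

(* Sequences are indexed from 0: [p 0] is the first and largest entry. *)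
Theorem proposition15 (R : realType) :
  exists c C : R, [/\ 0 < c, c <= C &
    forall p : nat -> R,
      (forall j, 0 <= p j <= 2^-1) -> (forall j, p j.+1 <= p j) ->
      exists mu : probability binseq R,
        (forall j, 'E_mu[coordinate R j] = (p j)%:E)%E /\
        forall n, (0 < n)%N ->
          ((c * Num.min (p 0%N) (Num.sqrt (p 0%N / n%:R)))%:E <= Delta n mu)%E /\
          (Delta n mu <= (C * Num.min (p 0%N) (Num.sqrt (p 0%N / n%:R)))%:E)%E].
Proof.
(* The constant 5 serves both upper bounds, whose factors are 2 and 5. *)
exists 16^-1, 5; split=> [||p p01 p_decr]; [lra|lra|].
have p_ge0 j : 0 <= p j by have /andP[] := p01 j.
have p_le j : p j <= 2^-1 by have /andP[] := p01 j.
have mean_p j : mean_of (threshold_law p) (coordinate R j) = p j.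
  by rewrite mean_of_threshold_law// p_ge0/=; have := p_le j; lra.
exists (threshold_law p); split=> [j|n n0].
  rewrite unlock integral_mean_of ?mean_p//.
  exact: bounded_measurable_coordinate.
have mu_decr := threshold_law_decreasing p_decr.
split; first exact: Delta_ge.
have := Delta_le_mean p_ge0 mean_p p_decr mu_decr n.
(* When [p 0 = 0] the minimum is 0 and the crude bound suffices; [Delta_le_sqrt] divides by
   [sqrt (p 0 / n)]. *)
have [p0|p0] := leP (p 0) 0.
  move=> /le_trans; apply; rewrite lee_fin.
  have -> : p 0 = 0 by apply/eqP; rewrite eq_le p0 p_ge0.
  by rewrite mul0r sqrtr0 minxx !mulr0.
case: (leP (p 0) (Num.sqrt _)) => _ h; last first.
  exact: (Delta_le_sqrt p_ge0 p_le mean_p mu_decr).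
by apply: (le_trans h); rewrite lee_fin; lra.
Qed.
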